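(* Let $C_1,C_2,C_3,C_4$ be bicollections. The exchange map $$R_{C_1,C_2,C_3,C_4}:(C_1\boxtimes C_2)\otimes_h(C_3\boxtimes C_4)\hookrightarrow(C_1\otimes_h C_3)\boxtimes(C_2\otimes_h C_4)$$ is an injective morphism of bicollections. Moreover, if $C$ is a collection, then there is an isomorphism of bicollections $$(C_1\boxtimes T(C))\otimes_h(C_2\boxtimes T(C))\;\simeq\;(C_1\otimes_h C_2)\boxtimes T(C).$$
   Context: All vector spaces are over $\mathbb C$. A collection is a family $C=(C(n))_{n\ge 1}$ of vector spaces. A bicollection is a family $P=(P(n,m))_{n,m\ge 0}$ of vector spaces (elements of $P(n,m)$ are thought of as operators with $n$ outputs and $m$ inputs); a morphism $P\to Q$ is a family of linear maps $P(n,m)\to Q(n,m)$. Horizontal tensor product: $(P\otimes_h Q)(n,m)=\bigoplus_{n_1+n_2=n,\ m_1+m_2=m}P(n_1,m_1)\otimes Q(n_2,m_2)$. Vertical tensor product: $(P\boxtimes Q)(n,m)=\bigoplus_{k\ge 0}P(n,k)\otimes Q(k,m)$. Elements are written $p\otimes_h q$ and $p\boxtimes q$ respectively. Exchange map: $R_{C_1,C_2,C_3,C_4}$ is the linear map given by $(p^1\boxtimes p^2)\otimes_h(p^3\boxtimes p^4)\mapsto(p^1\otimes_h p^3)\boxtimes(p^2\otimes_h p^4)$. For a collection $C$, $T(C)$ is the bicollection of words on $C$: $T(C)(0,0)=\mathbb C 1$, and for $(n,m)\neq(0,0)$, $T(C)(n,m)=\bigoplus_{k_1+\cdots+k_n=m,\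 k_i\ge 1}C(k_1)\otimes\cdots\otimes C(k_n)$ (words of length $n$ with $m$ inputs in total; it is $0$ when $n=0<m$). *)

(* Defs.v *)
From HB Require Import structures.
From mathcomp Require Import all_boot all_algebra.
From mathcomp Require Import boolp classical_sets cardinality.

Set Implicit Arguments.
Unset Strict Implicit.
Unset Printing Implicit Defensive.

Import GRing.Theory.
Local Open Scope ring_scope.
Local Open Scope quotient_scope.

Section DirectSum.
Variables (F : fieldType) (I : choiceType) (V : I -> lmodType F).

Record dsum := DSum {
  dsum_fun :> forall i, V i;
  dsum_finP : finite_set [set i | dsum_fun i != 0]%classic }.

Lemma dsum_eq (x y : dsum) : (forall i, x i = y i) -> x = y.
Proof.
case: x y => [f hf] [g hg] /= efg.
have fg : f = g by apply: functional_extensionality_dep.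
by subst g; congr DSum; exact: Prop_irrelevance.
Qed.

HB.instance Definition _ := gen_eqMixin dsum.
HB.instance Definition _ := gen_choiceMixin dsum.

Lemma dsum0_fin : finite_set [set i | (0 : V i) != 0]%classic.
Proof.
by apply: (sub_finite_set _ (@finite_set0 I)) => i /=; rewrite eqxx.
Qed.

Lemma dsumN_fin (x : dsum) : finite_set [set i | - x i != 0]%classic.
Proof.
by apply: sub_finite_set (dsum_finP x) => i /=; rewrite oppr_eq0.
Qed.

Lemma dsumD_fin (x y : dsum) : finite_set [set i | x i + y i != 0]%classic.
Proof.
have xy : finite_set ([set i | x i != 0] `|` [set i | y i != 0])%classic.
  by rewrite finite_setU; split; apply: dsum_finP.
apply: sub_finite_set xy => i /= xyi; apply: contrapT => /not_orP[].
by move=> /negP/negPn/eqP x0 /negP/negPn/eqP y0; rewrite x0 y0 addr0 eqxx in xyi.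
Qed.

Lemma dsumZ_fin (a : F) (x : dsum) : finite_set [set i | a *: x i != 0]%classic.
Proof.
apply: sub_finite_set (dsum_finP x) => i /=.
by apply: contra_neq => ->; rewrite scaler0.
Qed.

Definition dsum0 := DSum dsum0_fin.
Definition dsumN x := DSum (dsumN_fin x).
Definition dsumD x y := DSum (dsumD_fin x y).
Definition dsumZ a x := DSum (dsumZ_fin a x).

Lemma dsum_addA : associative dsumD.
Proof. by move=> x y z; apply: dsum_eq => i; exact: addrA. Qed.
Lemma dsum_addC : commutative dsumD.
Proof. by move=> x y; apply: dsum_eq => i; exact: addrC. Qed.
Lemma dsum_add0 : left_id dsum0 dsumD.
Proof. by move=> x; apply: dsum_eq => i; exact: add0r. Qed.
Lemma dsum_addN : left_inverse dsum0 dsumN dsumD.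
Proof. by move=> x; apply: dsum_eq => i; exact: addNr. Qed.
HB.instance Definition _ :=
  GRing.isZmodule.Build dsum dsum_addA dsum_addC dsum_add0 dsum_addN.

Lemma dsum_scaleA a b (x : dsum) : dsumZ a (dsumZ b x) = dsumZ (a * b) x.
Proof. by apply: dsum_eq => i; exact: scalerA. Qed.
Lemma dsum_scale1 : left_id 1 dsumZ.
Proof. by move=> x; apply: dsum_eq => i; exact: scale1r. Qed.
Lemma dsum_scaleDr : right_distributive dsumZ +%R.
Proof. by move=> a x y; apply: dsum_eq => i; exact: scalerDr. Qed.
Lemma dsum_scaleDl (x : dsum) : {morph dsumZ^~ x : a b / a + b}.
Proof. by move=> a b; apply: dsum_eq => i; exact: scalerDl. Qed.
HB.instance Definition _ := GRing.Zmodule_isLmodule.Build F dsum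
  dsum_scaleA dsum_scale1 dsum_scaleDr dsum_scaleDl.

(* The i-th injection: v at i, transported along i = j, and 0 elsewhere. *)
Definition dsum_in_fun (i : I) (v : V i) (j : I) : V j :=
  if i =P j is ReflectT ij then ecast k (V k) ij v else 0.

Lemma dsum_in_fin i (v : V i) :
  finite_set [set j | dsum_in_fun v j != 0]%classic.
Proof.
apply: sub_finite_set (finite_set1 i) => j /=; rewrite /dsum_in_fun.
by case: (i =P j) => [ij _|]; [exact: esym | rewrite eqxx].
Qed.

Definition dsum_in i (v : V i) : dsum := DSum (dsum_in_fin v).

End DirectSum.

Section Tensor.
Variables (F : fieldType) (V W : lmodType F).

(* The vector space with basis V * W, and its basis vectors. *)
Definition tfree : lmodType F := dsum (fun _ : V * W => F^o).
Definition tgen (v : V) (w : W) : tfree :=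
  @dsum_in F _ (fun _ : V * W => F^o) (v, w) 1.

(* The subspace spanned by the bilinearity relations; tensor is the quotient. *)
Inductive tensor_rel : tfree -> Prop :=
| tensor_relDl v v' w : tensor_rel (tgen (v + v') w - (tgen v w + tgen v' w))
| tensor_relDr v w w' : tensor_rel (tgen v (w + w') - (tgen v w + tgen v w'))
| tensor_relZl a v w : tensor_rel (tgen (a *: v) w - a *: tgen v w)
| tensor_relZr a v w : tensor_rel (tgen v (a *: w) - a *: tgen v w)
| tensor_rel0 : tensor_rel 0
| tensor_relD x y : tensor_rel x -> tensor_rel y -> tensor_rel (x + y)
| tensor_relZ a x : tensor_rel x -> tensor_rel (a *: x).

Definition tensor_rel_pred : {pred tfree} := fun x => `[< tensor_rel x >].

Lemma tensor_rel_zmod : zmod_closed tensor_rel_pred.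
Proof.
split=> [|x y /asboolP xr /asboolP yr]; apply/asboolP.
  exact: tensor_rel0.
by apply: tensor_relD => //; rewrite -scaleN1r; apply: tensor_relZ.
Qed.
HB.instance Definition _ :=
  GRing.isZmodClosed.Build tfree tensor_rel_pred tensor_rel_zmod.

Definition tensor := Quotient.quot tensor_rel_pred.
HB.instance Definition _ := GRing.Zmodule.on tensor.
HB.instance Definition _ := EqQuotient.on tensor.

Definition tensorZ (a : F) (x : tensor) : tensor := \pi_tensor (a *: repr x).

Lemma pi_tensorP (x y : tfree) :
  \pi_tensor x = \pi_tensor y <-> tensor_rel (x - y).
Proof.
split=> [/eqmodP|xy]; last by apply/eqmodP; apply/asboolP.
by rewrite /= /Quotient.equiv => /asboolP.
Qed.

Lemma pi_tensorZ a x : \pi_tensor (a *: x) = tensorZ a (\pi_tensor x).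
Proof.
apply/pi_tensorP; rewrite -scalerBr; apply: tensor_relZ.
by apply/pi_tensorP; rewrite reprK.
Qed.

Lemma pi_tensorD x y : \pi_tensor (x + y) = \pi_tensor x + \pi_tensor y.
Proof. exact: (@Quotient.pi_add tfree tensor_rel_pred x y). Qed.

Lemma tensor_scaleA a b x : tensorZ a (tensorZ b x) = tensorZ (a * b) x.
Proof. by elim/quotW: x => x; rewrite -(pi_tensorZ b) -!pi_tensorZ scalerA. Qed.
Lemma tensor_scale1 : left_id 1 tensorZ.
Proof. by elim/quotW=> x; rewrite -pi_tensorZ scale1r. Qed.
Lemma tensor_scaleDr : right_distributive tensorZ +%R.
Proof.
move=> a; elim/quotW=> x; elim/quotW=> y.
by rewrite -pi_tensorD -!pi_tensorZ -pi_tensorD scalerDr.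
Qed.
Lemma tensor_scaleDl x : {morph tensorZ^~ x : a b / a + b}.
Proof.
by move=> a b /=; elim/quotW: x => x; rewrite -!pi_tensorZ -pi_tensorD scalerDl.
Qed.
HB.instance Definition _ := GRing.Zmodule_isLmodule.Build F tensor
  tensor_scaleA tensor_scale1 tensor_scaleDr tensor_scaleDl.

Definition pure_tensor (v : V) (w : W) : tensor := \pi_tensor (tgen v w).

End Tensor.

Section Bicollections.
Variable F : fieldType.

Definition posnat := {k : nat | (0 < k)%N}.

Definition collection := posnat -> lmodType F.

(* P n m: operators with n outputs and m inputs. *)
Definition bicollection := nat -> nat -> lmodType F.

Definition bimor (P Q : bicollection) := forall n m, {linear P n m -> Q n m}.

Definition bi_injective (P Q : bicollection) (f : bimor P Q) :=
  forall n m, injective (f n m).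

Definition bi_isomorphic (P Q : bicollection) :=
  exists (f : bimor P Q) (g : bimor Q P),
    forall n m, cancel (f n m) (g n m) /\ cancel (g n m) (f n m).

Definition splitting (n : nat) := {ij : nat * nat | (ij.1 + ij.2 == n)%N}.

Definition split_sum (i j : nat) : splitting (i + j) :=
  exist (fun ij : nat * nat => (ij.1 + ij.2 == i + j)%N) (i, j) (eqxx _).

Section Products.
Variables P Q : bicollection.

Definition hsummand n m (a : splitting n * splitting m) : lmodType F :=
  tensor (P (val a.1).1 (val a.2).1) (Q (val a.1).2 (val a.2).2).

Definition htensor : bicollection := fun n m => dsum (@hsummand n m).

Definition vsummand n m (k : nat) : lmodType F := tensor (P n k) (Q k m).

Definition vtensor : bicollection := fun n m => dsum (vsummand n m).

Definition hpure n1 m1 n2 m2 (p : P n1 m1) (q : Q n2 m2) :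
    htensor (n1 + n2)%N (m1 + m2)%N :=
  @dsum_in F _ (@hsummand _ _) (split_sum n1 n2, split_sum m1 m2) (pure_tensor p q).

Definition vpure n k m (p : P n k) (q : Q k m) : vtensor n m :=
  @dsum_in F _ (vsummand n m) k (pure_tensor p q).

End Products.

(* The values on these elements determine f, as they span the source. *)
Definition exchange_spec (C1 C2 C3 C4 : bicollection)
    (f : bimor (htensor (vtensor C1 C2) (vtensor C3 C4))
               (vtensor (htensor C1 C3) (htensor C2 C4))) :=
  forall n k m n' k' m' (p1 : C1 n k) (p2 : C2 k m)
         (p3 : C3 n' k') (p4 : C4 k' m'),
    f (n + n')%N (m + m')%N (hpure (vpure p1 p2) (vpure p3 p4))
    = vpure (hpure p1 p3) (hpure p2 p4).

Section Words.
Variable C : collection.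

(* For s = (k_1, ..., k_n), C(k_1) (x) ... (x) C(k_n); the empty product is the ground field. *)
Fixpoint word (s : seq posnat) : lmodType F :=
  match s with
  | [::] => F^o
  | k :: s' => if s' is [::] then C k else tensor (C k) (word s')
  end.

Definition composition (n m : nat) :=
  {k : n.-tuple posnat | (\sum_(i < n) val (tnth k i) == m)%N}.

(* For n = 0 there is only the empty composition, of m = 0; so this is the
   ground field for (n, m) = (0, 0) and zero for n = 0 < m. *)
Definition words : bicollection :=
  fun n m => dsum (fun k : composition n m => word (val k)).

End Words.
End Bicollections.

Declare Scope bicollection_scope.
Delimit Scope bicollection_scope with bicol.
Notation "P '⊗h' Q" := (htensor P Q)
  (at level 40, left associativity) : bicollection_scope.
Notation "P '⊠' Q" := (vtensor P Q)
  (at level 40, left associativity) : bicollection_scope.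

(* Main.v *)
Require Import Defs.
From HB Require Import structures.
From mathcomp Require Import all_boot all_algebra.
From mathcomp Require Import boolp classical_sets cardinality.
From mathcomp Require Import reals complex.

Set Implicit Arguments.
Unset Strict Implicit.
Unset Printing Implicit Defensive.

Import GRing.Theory.
Local Open Scope ring_scope.
Local Open Scope quotient_scope.

(** Everything is done over an arbitrary field, with no bases. Maps out of a
direct sum of tensor products are given by families of bilinear maps, and two
linear maps agree as soon as they agree on pure elements.

The exchange map R sends (p1 v p2) h (p3 v p4) to (p1 h p3) v (p2 h p4), where
v and h denote the vertical and horizontal products of elements. Its target has
more summands than its image meets: in a product (p1 h p3) v (p2 h p4) the
numbers of inputs of p1, p3 and of outputs of p2, p4 need only have the same sum. Projecting to the
summands where they agree one by one gives a linear map back, [unexchange],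
with [unexchange] o R = id ([exchangeK]). Hence R is injective.

For words nothing is missing once they are concatenated. Concatenation identifies
the direct sum over m1 + m2 = m of the T(C)(k1, m1) (x) T(C)(k2, m2) with
T(C)(k1 + k2, m): a word of length k1 + k2 is cut uniquely after its k1-th
letter. So the composite of R with concatenation,
(p1 v x1) h (p2 v x2) |-> (p1 h p2) v (x1 x2), is invertible: its inverse cuts
the word w in (p1 h p2) v w according to the numbers of inputs of p1 and p2 and
then applies [unexchange]. Two facts carry this: cutting undoes concatenation
([words_catK]), and the words x1 x2 with x1 of length k1 and x2 of length k2
span T(C)(k1 + k2, -) ([words_cat_ind]). *)

(** * Spaces of linear maps, and universal properties *)

Section LHom.
Variables (F : fieldType) (V W : lmodType F).

(** The vector space of linear maps from V to W. A bilinear map is an element of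
[lhom V (lhom W U)], so that universal properties can be stated by currying. *)
Record lhom := LHom { lhom_fun :> V -> W; lhom_linear : linear lhom_fun }.

HB.instance Definition _ (f : lhom) :=
  GRing.isLinear.Build F V W *:%R (lhom_fun f) (lhom_linear f).

Lemma lhom_lin (f : lhom) a x y : f (a *: x + y) = a *: f x + f y.
Proof. exact: lhom_linear. Qed.

Lemma lhom_add (f : lhom) x y : f (x + y) = f x + f y.
Proof. exact: linearD. Qed.

Lemma lhom_sub (f : lhom) x y : f (x - y) = f x - f y.
Proof. exact: linearB. Qed.

Lemma lhom_scale (f : lhom) a x : f (a *: x) = a *: f x.
Proof. exact: linearZ. Qed.

Lemma lhom_zero (f : lhom) : f 0 = 0.
Proof. exact: linear0. Qed.

Lemma lhom_eq (f g : lhom) : f =1 g -> f = g.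
Proof.
case: f g => [f hf] [g hg] /= /funext fg; subst g.
by congr LHom; exact: Prop_irrelevance.
Qed.

HB.instance Definition _ := gen_eqMixin lhom.
HB.instance Definition _ := gen_choiceMixin lhom.

Lemma lhom0_linear : linear (fun _ : V => 0 : W).
Proof. by move=> a x y; rewrite scaler0 addr0. Qed.
Lemma lhomN_linear (f : lhom) : linear (fun x => - f x).
Proof. by move=> a x y; rewrite linearP opprD scalerN. Qed.
Lemma lhomD_linear (f g : lhom) : linear (fun x => f x + g x).
Proof. by move=> a x y; rewrite !lhom_lin scalerDr addrACA. Qed.
Lemma lhomZ_linear b (f : lhom) : linear (fun x => b *: f x).
Proof. by move=> a x y; rewrite linearP scalerDr !scalerA mulrC. Qed.

Definition lhom0 := LHom lhom0_linear.
Definition lhomN f := LHom (lhomN_linear f).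
Definition lhomD f g := LHom (lhomD_linear f g).
Definition lhomZ b f := LHom (lhomZ_linear b f).

Fact lhom_addA : associative lhomD.
Proof. by move=> x y z; apply: lhom_eq => i; exact: addrA. Qed.
Fact lhom_addC : commutative lhomD.
Proof. by move=> x y; apply: lhom_eq => i; exact: addrC. Qed.
Fact lhom_add0 : left_id lhom0 lhomD.
Proof. by move=> x; apply: lhom_eq => i; exact: add0r. Qed.
Fact lhom_addN : left_inverse lhom0 lhomN lhomD.
Proof. by move=> x; apply: lhom_eq => i; exact: addNr. Qed.
HB.instance Definition _ :=
  GRing.isZmodule.Build lhom lhom_addA lhom_addC lhom_add0 lhom_addN.

Fact lhom_scaleA a b (x : lhom) : lhomZ a (lhomZ b x) = lhomZ (a * b) x.
Proof. by apply: lhom_eq => i; exact: scalerA. Qed.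
Fact lhom_scale1 : left_id 1 lhomZ.
Proof. by move=> x; apply: lhom_eq => i; exact: scale1r. Qed.
Fact lhom_scaleDr : right_distributive lhomZ +%R.
Proof. by move=> a x y; apply: lhom_eq => i; exact: scalerDr. Qed.
Fact lhom_scaleDl (x : lhom) : {morph lhomZ^~ x : a b / a + b}.
Proof. by move=> a b; apply: lhom_eq => i; exact: scalerDl. Qed.
HB.instance Definition _ := GRing.Zmodule_isLmodule.Build F lhom
  lhom_scaleA lhom_scale1 lhom_scaleDr lhom_scaleDl.

Lemma lhomPE a (f g : lhom) x : (a *: f + g) x = a *: f x + g x.
Proof. by []. Qed.

End LHom.

Section Bilinear.
Variables (F : fieldType) (V W U : lmodType F) (f : V -> W -> U).
Hypothesis f_linl : forall a v v' w, f (a *: v + v') w = a *: f v w + f v' w.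
Hypothesis f_linr : forall a v w w', f v (a *: w + w') = a *: f v w + f v w'.

Fact bilin_subproof : linear (fun v => LHom (fun a => f_linr a v)).
Proof. by move=> a v v'; apply: lhom_eq => w /=; exact: f_linl. Qed.

(** A bilinear map in curried form. *)
Definition bilin : lhom V (lhom W U) := LHom bilin_subproof.

Lemma bilinE v w : bilin v w = f v w.
Proof. by []. Qed.

End Bilinear.

(** Closure under the combinations a x + y: what a property of vectors needs in
order to hold everywhere once it holds on a spanning set (and at 0, if the
spanning set may be empty). *)
Definition lin_closed (F : fieldType) (V : lmodType F) (Q : V -> Prop) :=
  forall a x y, Q x -> Q y -> Q (a *: x + y).

Section DsumTheory.
Variables (F : fieldType) (I : choiceType) (V : I -> lmodType F).

Lemma dsumPE a (x y : dsum V) i : (a *: x + y) i = a *: x i + y i.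
Proof. by []. Qed.

Lemma dsum_in_id i (v : V i) : dsum_in v i = v.
Proof.
rewrite /dsum_in /= /dsum_in_fun; case: eqP => // e.
by rewrite (eq_irrelevance e erefl).
Qed.

Lemma dsum_in_neq i j (v : V i) : i != j -> dsum_in v j = 0.
Proof. by rewrite /dsum_in /= /dsum_in_fun; case: eqP. Qed.

Lemma dsum_inP i a (v w : V i) :
  dsum_in (a *: v + w) = a *: dsum_in v + dsum_in w.
Proof.
apply: dsum_eq => j; rewrite dsumPE; have [<-|ij] := eqVneq i j.
  by rewrite !dsum_in_id.
by rewrite !(dsum_in_neq _ ij) scaler0 addr0.
Qed.

Definition dsum_inj i : lhom (V i) (dsum V) := LHom (@dsum_inP i).

(** The support of an element, as a duplicate-free sequence. *)
Lemma dsum_supp (x : dsum V) : exists s, uniq s /\ forall i, x i != 0 -> i \in s.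
Proof.
have /finite_seqP[s sE] := dsum_finP x.
exists (undup s); split; first exact: undup_uniq.
by move=> i xi; rewrite mem_undup; have : [set` s]%classic i by rewrite -sE.
Qed.

Lemma dsum_ind (Q : dsum V -> Prop) :
  Q 0 -> lin_closed Q -> (forall i (v : V i), Q (dsum_in v)) -> forall x, Q x.
Proof.
move=> Q0 Qlin Qin x; have [s [_]] := dsum_supp x.
elim: s x => [|i s IHs] x xs.
  suff -> : x = 0 by [].
  apply: dsum_eq => i; apply/eqP; have := xs i; rewrite in_nil.
  by case: eqP => //= _ /(_ isT).
have -> : x = 1 *: dsum_in (x i) + (x - dsum_in (x i)).
  by rewrite scale1r addrC subrK.
apply: Qlin => //; apply: IHs => j.
have -> : (x - dsum_in (x i)) j = x j - dsum_in (x i) j by [].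
have [<-|ij] := eqVneq i j; first by rewrite dsum_in_id subrr eqxx.
rewrite dsum_in_neq // subr0 => /xs; rewrite inE eq_sym.
by rewrite (negbTE ij).
Qed.

Section Lift.
Variables (U : lmodType F) (f : forall i, lhom (V i) U).

(** The linear map out of a direct sum with components f i. *)
Definition dlift_fun (x : dsum V) : U :=
  \sum_(i <- sval (cid (dsum_supp x))) f i (x i).

(** The sum may be taken over any finite set containing the support. *)
Lemma dlift_funE (x : dsum V) (s : seq I) :
  uniq s -> (forall i, x i != 0 -> i \in s) ->
  dlift_fun x = \sum_(i <- s) f i (x i).
Proof.
rewrite /dlift_fun; case: (cid _) => /= s' [us' xs'] us xs.
(* Terms outside the support vanish, so both sums reduce to the support. *)
pose t (r : seq I) := [seq i <- r | x i != 0].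
have sumE (r : seq I) : \sum_(i <- r) f i (x i) = \sum_(i <- t r) f i (x i).
  rewrite big_filter [RHS]big_mkcond /=; apply: eq_bigr => i _.
  by case: eqP => //= ->; rewrite linear0.
rewrite sumE [RHS]sumE; apply: perm_big; apply: uniq_perm.
- exact: filter_uniq.
- exact: filter_uniq.
move=> i; rewrite !mem_filter; case: eqP => //= /eqP xi.
by rewrite xs // xs'.
Qed.

Lemma dlift_linear : linear dlift_fun.
Proof.
move=> a x y; have [[sx [_ xs]] [sy [_ ys]]] := (dsum_supp x, dsum_supp y).
pose s := undup (sx ++ sy).
have us : uniq s by exact: undup_uniq.
have sE i : (i \in s) = (i \in sx) || (i \in sy) by rewrite mem_undup mem_cat.
have xs' i : x i != 0 -> i \in s by rewrite sE => /xs ->.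
have ys' i : y i != 0 -> i \in s by rewrite sE => /ys ->; rewrite orbT.
rewrite !(@dlift_funE _ s) //; last first.
  move=> i; rewrite dsumPE.
  have [xi0|/xs' //] := eqVneq (x i) 0; have [yi0|/ys' //] := eqVneq (y i) 0.
  by rewrite xi0 yi0 scaler0 addr0 eqxx.
rewrite scaler_sumr -big_split /=; apply: eq_bigr => i _.
by rewrite lhom_lin.
Qed.

Definition dlift : lhom (dsum V) U := LHom dlift_linear.

Lemma dliftE i (v : V i) : dlift (dsum_in v) = f i v.
Proof.
rewrite [LHS](@dlift_funE _ [:: i]) //.
  by rewrite big_seq1 dsum_in_id.
move=> j; rewrite inE; have [//|ij] := eqVneq j i.
by rewrite dsum_in_neq ?eqxx // eq_sym.
Qed.

End Lift.
End DsumTheory.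

Fact sub_addl (V : zmodType) (x y z t : V) : x - (z + t) = x - (y + t) + (y - z).
Proof. by rewrite !opprD !addrA [x - y - t + y]addrAC subrK addrAC. Qed.

Section TensorTheory.
Variables (F : fieldType) (V W : lmodType F).

Lemma pi_tensorP_lin a x y :
  \pi_(tensor V W) (a *: x + y) = a *: \pi_(tensor V W) x + \pi_(tensor V W) y.
Proof. by rewrite pi_tensorD pi_tensorZ. Qed.

Lemma pi_tensor0 : \pi_(tensor V W) 0 = 0.
Proof.
by have := pi_tensorP_lin (-1) 0 0; rewrite scaler0 addr0 scaleN1r addNr.
Qed.

Lemma pure_tensorPl a (v v' : V) (w : W) :
  pure_tensor (a *: v + v') w = a *: pure_tensor v w + pure_tensor v' w.
Proof.
rewrite /pure_tensor -pi_tensorP_lin; apply/pi_tensorP.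
rewrite (sub_addl _ (tgen (a *: v) w)).
by apply: tensor_relD; [exact: tensor_relDl|exact: tensor_relZl].
Qed.

Lemma pure_tensorPr a (v : V) (w w' : W) :
  pure_tensor v (a *: w + w') = a *: pure_tensor v w + pure_tensor v w'.
Proof.
rewrite /pure_tensor -pi_tensorP_lin; apply/pi_tensorP.
rewrite (sub_addl _ (tgen v (a *: w))).
by apply: tensor_relD; [exact: tensor_relDr|exact: tensor_relZr].
Qed.

Lemma dsum_in_tgen v w (c : F^o) :
  @dsum_in F _ (fun _ : V * W => F^o) (v, w) c = c *: tgen v w.
Proof.
have := @dsum_inP F _ (fun _ : V * W => F^o) (v, w) c 1 0.
have -> : (c *: 1 + 0 : F^o) = c by rewrite addr0; exact: mulr1.
move=> ->; rewrite -[RHS]addr0; congr (_ + _).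
exact: (lhom_zero (dsum_inj (fun _ : V * W => F^o) (v, w))).
Qed.

Lemma tensor_ind (Q : tensor V W -> Prop) :
  lin_closed Q -> (forall v w, Q (pure_tensor v w)) -> forall x, Q x.
Proof.
move=> Qlin Qpure; have Q0 : Q 0.
  by rewrite -(addNr (pure_tensor 0 0)) -scaleN1r; apply: Qlin.
elim/quotW; apply: dsum_ind => [|a x y Qx Qy|[v w] c].
- by rewrite pi_tensor0.
- by rewrite pi_tensorP_lin; apply: Qlin.
- rewrite dsum_in_tgen -[_ *: _]addr0 pi_tensorP_lin pi_tensor0.
  by apply: Qlin => //; exact: Qpure.
Qed.

Section Lift.
Variables (U : lmodType F) (f : lhom V (lhom W U)).

Fact tfree_lift_linear (vw : V * W) : linear (fun c : F^o => c *: f vw.1 vw.2).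
Proof. by move=> a x y; rewrite scalerDl -scalerA. Qed.

(** The extension of a bilinear map to the space with basis V * W; it kills the
bilinearity relations, so it factors through the tensor product as [tlift]. *)
Definition tfree_lift : lhom (tfree V W) U :=
  dlift (fun vw : V * W => LHom (tfree_lift_linear vw)).

Lemma tfree_liftE v w : tfree_lift (tgen v w) = f v w.
Proof. by rewrite /tfree_lift dliftE /= scale1r. Qed.

Lemma tfree_lift_rel x : tensor_rel x -> tfree_lift x = 0.
Proof.
elim=> {x}[v v' w|v w w'|a v w|a v w||x y _ xr _ yr|a x _ xr].
- by rewrite lhom_sub lhom_add !tfree_liftE lhom_add; exact: subrr.
- by rewrite lhom_sub lhom_add !tfree_liftE lhom_add subrr.
- by rewrite lhom_sub lhom_scale !tfree_liftE lhom_scale; exact: subrr.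
- by rewrite lhom_sub lhom_scale !tfree_liftE lhom_scale subrr.
- exact: lhom_zero.
- by rewrite lhom_add xr yr addr0.
- by rewrite lhom_scale xr scaler0.
Qed.

Definition tlift_fun (x : tensor V W) : U := tfree_lift (repr x).

Lemma tlift_pi x : tlift_fun (\pi x) = tfree_lift x.
Proof.
apply/eqP; rewrite -subr_eq0 -lhom_sub; apply/eqP/tfree_lift_rel.
by apply/pi_tensorP; rewrite reprK.
Qed.

Fact tlift_linear : linear tlift_fun.
Proof.
move=> a; elim/quotW=> x; elim/quotW=> y.
by rewrite -pi_tensorP_lin !tlift_pi lhom_lin.
Qed.

(** The linear map out of a tensor product given by a bilinear map. *)
Definition tlift : lhom (tensor V W) U := LHom tlift_linear.

Lemma tliftE v w : tlift (pure_tensor v w) = f v w.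
Proof. by rewrite [LHS]tlift_pi tfree_liftE. Qed.

End Lift.
End TensorTheory.

Section Maps.
Variables (F : fieldType).

Fact lhom_id_linear (V : lmodType F) : linear (@idfun V).
Proof. by []. Qed.
Definition lhom_id (V : lmodType F) : lhom V V := LHom (@lhom_id_linear V).

Section Comp.
Variables (V W U : lmodType F).

Fact lhom_comp_linear (g : lhom W U) (f : lhom V W) : linear (g \o f).
Proof. by move=> a x y /=; rewrite !lhom_lin. Qed.
Definition lhom_comp g f : lhom V U := LHom (lhom_comp_linear g f).

Lemma lhom_compE g f x : lhom_comp g f x = g (f x).
Proof. by []. Qed.

Definition tpure : lhom V (lhom W (tensor V W)) :=
  bilin (@pure_tensorPl F V W) (@pure_tensorPr F V W).

Lemma pure_tensorZl a (v : V) (w : W) :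
  pure_tensor (a *: v) w = a *: pure_tensor v w.
Proof.
have -> : pure_tensor (a *: v) w = tpure (a *: v) w by [].
by rewrite lhom_scale.
Qed.

Lemma pure_tensorZr a (v : V) (w : W) :
  pure_tensor v (a *: w) = a *: pure_tensor v w.
Proof. exact: (lhom_scale (tpure v)). Qed.

End Comp.

Section TMap.
Variables (V V' W W' : lmodType F) (f : lhom V V') (g : lhom W W').

Fact tmap_subproofl a v v' w :
  pure_tensor (f (a *: v + v')) (g w)
  = a *: pure_tensor (f v) (g w) + pure_tensor (f v') (g w).
Proof. by rewrite lhom_lin pure_tensorPl. Qed.

Fact tmap_subproofr a v w w' :
  pure_tensor (f v) (g (a *: w + w'))
  = a *: pure_tensor (f v) (g w) + pure_tensor (f v) (g w').
Proof. by rewrite lhom_lin pure_tensorPr. Qed.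

(** The tensor product of two linear maps. *)
Definition tmap : lhom (tensor V W) (tensor V' W') :=
  tlift (bilin tmap_subproofl tmap_subproofr).

Lemma tmapE v w : tmap (pure_tensor v w) = pure_tensor (f v) (g w).
Proof. by rewrite /tmap tliftE. Qed.

End TMap.

Lemma tmapPl (V V' W W' : lmodType F) a (f f' : lhom V V') (g : lhom W W') x :
  tmap (a *: f + f') g x = a *: tmap f g x + tmap f' g x.
Proof.
elim/tensor_ind: x => [b x y Hx Hy|v w].
  by rewrite !lhom_lin Hx Hy !scalerDr !scalerA mulrC addrACA.
by rewrite !tmapE lhomPE pure_tensorPl.
Qed.

End Maps.

Section Products.
Variables (F : fieldType) (P Q : bicollection F).

Lemma vpurePl n k m a (p p' : P n k) (q : Q k m) :
  vpure (a *: p + p') q = a *: vpure p q + vpure p' q.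
Proof. by rewrite /vpure pure_tensorPl (@dsum_inP F _ (vsummand P Q n m) k). Qed.

Lemma vpurePr n k m a (p : P n k) (q q' : Q k m) :
  vpure p (a *: q + q') = a *: vpure p q + vpure p q'.
Proof. by rewrite /vpure pure_tensorPr (@dsum_inP F _ (vsummand P Q n m) k). Qed.

Lemma hpurePl n1 m1 n2 m2 a (p p' : P n1 m1) (q : Q n2 m2) :
  hpure (a *: p + p') q = a *: hpure p q + hpure p' q.
Proof. by rewrite /hpure pure_tensorPl (dsum_inP (V := @hsummand F P Q _ _)). Qed.

Lemma hpurePr n1 m1 n2 m2 a (p : P n1 m1) (q q' : Q n2 m2) :
  hpure p (a *: q + q') = a *: hpure p q + hpure p q'.
Proof. by rewrite /hpure pure_tensorPr (dsum_inP (V := @hsummand F P Q _ _)). Qed.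

Lemma vpure0r n k m (p : P n k) : vpure p (0 : Q k m) = 0.
Proof.
by have := vpurePr (-1) p (0 : Q k m) 0; rewrite scaler0 addr0 scaleN1r addNr.
Qed.

Lemma hpure0l n1 m1 n2 m2 (q : Q n2 m2) : hpure (0 : P n1 m1) q = 0.
Proof.
by have := hpurePl (-1) (0 : P n1 m1) 0 q; rewrite scaler0 addr0 scaleN1r addNr.
Qed.

Lemma hpure0r n1 m1 n2 m2 (p : P n1 m1) : hpure p (0 : Q n2 m2) = 0.
Proof.
by have := hpurePr (-1) p (0 : Q n2 m2) 0; rewrite scaler0 addr0 scaleN1r addNr.
Qed.

(** Pure elements span both products. As there is at least one summand, 0 is a
combination of pure elements and needs no separate case. *)
Lemma vtensor_ind n m (Z : vtensor P Q n m -> Prop) :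
  lin_closed Z -> (forall k p q, Z (@vpure F P Q n k m p q)) -> forall x, Z x.
Proof.
move=> Zlin Zpure; apply: dsum_ind => // [|k].
  by rewrite -(addNr (vpure (0 : P n 0%N) 0)) -scaleN1r; apply: Zlin.
apply: tensor_ind => [a x y Zx Zy|p q]; last exact: Zpure.
by rewrite (@dsum_inP F _ (vsummand P Q n m)); apply: Zlin.
Qed.

Lemma htensor_ind (Z : forall n m, htensor P Q n m -> Prop) :
  (forall n m, lin_closed (@Z n m)) ->
  (forall n1 m1 n2 m2 (p : P n1 m1) (q : Q n2 m2), Z _ _ (hpure p q)) ->
  forall n m x, Z n m x.
Proof.
move=> Zlin Zpure n m.
have Zin a (x : @hsummand F P Q n m a) : Z n m (dsum_in x).
  elim/tensor_ind: x => [c x y Zx Zy|].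
    by rewrite (dsum_inP (V := @hsummand F P Q n m)); apply: Zlin.
  case: a => [[[n1 n2] en] [[m1 m2] em]] /= p q.
  have nE : (n1 + n2 = n)%N by exact/eqP.
  have mE : (m1 + m2 = m)%N by exact/eqP.
  subst n m.
  rewrite (eq_irrelevance en (eqxx _)) (eq_irrelevance em (eqxx _)).
  exact: Zpure.
apply: dsum_ind => //; first last; first exact: Zlin.
have eq0 k : (0 + k == k)%N by [].
rewrite -(lhom_zero (dsum_inj (@hsummand F P Q n m)
  (exist _ (0%N, n) (eq0 n), exist _ (0%N, m) (eq0 m)))).
exact: Zin.
Qed.

Section VLift.
Variables (n m : nat) (U : lmodType F) (f : forall k, lhom (P n k) (lhom (Q k m) U)).

(** The map out of a vertical product given by a family of bilinear maps. *)
Definition vlift : lhom (vtensor P Q n m) U := dlift (fun k => tlift (f k)).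

Lemma vliftE k (p : P n k) (q : Q k m) : vlift (vpure p q) = f k p q.
Proof. by rewrite [LHS]dliftE tliftE. Qed.

End VLift.

Section HLift.
Variables (U : bicollection F)
  (f : forall n1 m1 n2 m2, lhom (P n1 m1) (lhom (Q n2 m2) (U (n1 + n2)%N (m1 + m2)%N))).

(** The component at a summand; a splitting of n only gives n1 + n2 = n as a
proposition, along which the target is transported. *)
Definition hlift_at n1 m1 n2 m2 n m (en : (n1 + n2)%N = n)
    (em : (m1 + m2)%N = m) : lhom (P n1 m1) (lhom (Q n2 m2) (U n m)) :=
  match en in _ = n', em in _ = m'
    return lhom (P n1 m1) (lhom (Q n2 m2) (U n' m')) with
  | erefl, erefl => f n1 m1 n2 m2
  end.

Definition hlift_summand n m (a : splitting n * splitting m) :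
    lhom (@hsummand F P Q n m a) (U n m) :=
  tlift (@hlift_at (val a.1).1 (val a.2).1 (val a.1).2 (val a.2).2 n m
           (eqP (valP a.1)) (eqP (valP a.2))).

(** The map of bicollections out of a horizontal product given by a family of
bilinear maps. *)
Definition hlift n m : lhom (htensor P Q n m) (U n m) :=
  dlift (@hlift_summand n m).

Lemma hliftE n1 m1 n2 m2 (p : P n1 m1) (q : Q n2 m2) :
  hlift _ _ (hpure p q) = f n1 m1 n2 m2 p q.
Proof.
rewrite [LHS]dliftE [LHS]tliftE /=.
by rewrite (eq_irrelevance (eqP _) erefl) (eq_irrelevance (eqP _) erefl).
Qed.

End HLift.
End Products.

(** * The exchange map *)

Section Exchange.
Variables (F : fieldType) (C1 C2 C3 C4 : bicollection F).

Let S := htensor (vtensor C1 C2) (vtensor C3 C4).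
Let T := vtensor (htensor C1 C3) (htensor C2 C4).

Section Components.
Variables (n m n' m' : nat).

Section Inner.
Variables (k : nat) (p1 : C1 n k) (p2 : C2 k m).

(** The exchange map with p1 and p2 fixed. *)
Definition exchange_right : lhom (vtensor C3 C4 n' m') (T (n + n') (m + m')) :=
  vlift (fun k' => @bilin F (C3 n' k') (C4 k' m') (T (n + n') (m + m'))
    (fun p3 p4 => vpure (hpure p1 p3) (hpure p2 p4))
    (fun a v v' w => etrans (congr1 (fun x => vpure x _) (hpurePr a _ v v'))
                            (vpurePl a _ _ _))
    (fun a v w w' => etrans (congr1 (fun x => vpure _ x) (hpurePr a _ w w'))
                            (vpurePr a _ _ _))).

Lemma exchange_rightE k' (p3 : C3 n' k') (p4 : C4 k' m') :
  exchange_right (vpure p3 p4) = vpure (hpure p1 p3) (hpure p2 p4).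
Proof. exact: vliftE. Qed.

End Inner.

Fact exchange_rightPl k a (p p' : C1 n k) (p2 : C2 k m) :
  exchange_right (a *: p + p') p2 = a *: exchange_right p p2 + exchange_right p' p2.
Proof.
apply: lhom_eq; elim/vtensor_ind => [b x y Hx Hy|k' p3 p4].
  by rewrite !lhom_lin Hx Hy.
by rewrite lhomPE !exchange_rightE hpurePl vpurePl.
Qed.

Fact exchange_rightPr k a (p1 : C1 n k) (p p' : C2 k m) :
  exchange_right p1 (a *: p + p') = a *: exchange_right p1 p + exchange_right p1 p'.
Proof.
apply: lhom_eq; elim/vtensor_ind => [b x y Hx Hy|k' p3 p4].
  by rewrite !lhom_lin Hx Hy.
by rewrite lhomPE !exchange_rightE hpurePl vpurePr.
Qed.

Definition exchange_comp :
    lhom (vtensor C1 C2 n m) (lhom (vtensor C3 C4 n' m') (T (n + n') (m + m'))) :=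
  vlift (fun k => bilin (@exchange_rightPl k) (@exchange_rightPr k)).

Lemma exchange_compE k k' (p1 : C1 n k) (p2 : C2 k m) (p3 : C3 n' k') (p4 : C4 k' m') :
  exchange_comp (vpure p1 p2) (vpure p3 p4) = vpure (hpure p1 p3) (hpure p2 p4).
Proof. by rewrite /exchange_comp vliftE bilinE exchange_rightE. Qed.

End Components.

(** The exchange map. *)
Definition exchange n m : lhom (S n m) (T n m) :=
  hlift (fun n1 m1 n2 m2 => @exchange_comp n1 m1 n2 m2) n m.

Lemma exchangeE n k m n' k' m' (p1 : C1 n k) (p2 : C2 k m)
    (p3 : C3 n' k') (p4 : C4 k' m') :
  exchange _ _ (hpure (vpure p1 p2) (vpure p3 p4))
  = vpure (hpure p1 p3) (hpure p2 p4).
Proof. by rewrite /exchange hliftE exchange_compE. Qed.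

(** The source of the exchange map is spanned by products of four elements. *)
Lemma exchange_source_ind (Z : forall n m, S n m -> Prop) :
  (forall n m, lin_closed (@Z n m)) ->
  (forall n k m n' k' m' (p1 : C1 n k) (p2 : C2 k m) (p3 : C3 n' k') (p4 : C4 k' m'),
     Z _ _ (hpure (vpure p1 p2) (vpure p3 p4))) ->
  forall n m x, Z n m x.
Proof.
move=> Zlin Zpure; apply: htensor_ind => // n1 m1 n2 m2.
elim/vtensor_ind=> [a x y Zx Zy q|k1 p1 p2].
  by rewrite hpurePl; apply: Zlin.
elim/vtensor_ind=> [a x y Zx Zy|k2 p3 p4]; last exact: Zpure.
by rewrite hpurePr; apply: Zlin.
Qed.

(** A left inverse of the exchange map. The vector p2 in C2(b1, m1) is replaced
by its component of index k1 in the direct sum of the C2(b, m1), which is p2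
when b1 = k1 and 0 otherwise; likewise for p4. So the summands where the
intermediate numbers do not match are sent to 0. *)
Section Inverse.

Section Inner.
Variables (n1 k1 n2 k2 : nat).

Definition unexchange_pure (p1 : C1 n1 k1) (p3 : C3 n2 k2)
    b1 m1 b2 m2 (p2 : C2 b1 m1) (p4 : C4 b2 m2) : S (n1 + n2) (m1 + m2) :=
  hpure (vpure p1 (@dsum_in F nat (fun b => C2 b m1) b1 p2 k1))
        (vpure p3 (@dsum_in F nat (fun b => C4 b m2) b2 p4 k2)).

Variables (p1 : C1 n1 k1) (p3 : C3 n2 k2).

Fact unexchange_purePl b1 m1 b2 m2 a (p p' : C2 b1 m1) (p4 : C4 b2 m2) :
  unexchange_pure p1 p3 (a *: p + p') p4
  = a *: unexchange_pure p1 p3 p p4 + unexchange_pure p1 p3 p' p4.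
Proof.
by rewrite /unexchange_pure (dsum_inP (V := fun b => C2 b m1)) dsumPE vpurePr hpurePl.
Qed.

Fact unexchange_purePr b1 m1 b2 m2 a (p2 : C2 b1 m1) (p p' : C4 b2 m2) :
  unexchange_pure p1 p3 p2 (a *: p + p')
  = a *: unexchange_pure p1 p3 p2 p + unexchange_pure p1 p3 p2 p'.
Proof.
by rewrite /unexchange_pure (dsum_inP (V := fun b => C4 b m2)) dsumPE vpurePr hpurePr.
Qed.

Definition unexchange_right k m : lhom (htensor C2 C4 k m) (S (n1 + n2) m) :=
  hlift (U := fun _ m => S (n1 + n2) m)
    (fun b1 m1 b2 m2 =>
       bilin (@unexchange_purePl b1 m1 b2 m2) (@unexchange_purePr b1 m1 b2 m2)) k m.

Lemma unexchange_rightE b1 m1 b2 m2 (p2 : C2 b1 m1) (p4 : C4 b2 m2) :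
  unexchange_right _ _ (hpure p2 p4) = unexchange_pure p1 p3 p2 p4.
Proof. by rewrite /unexchange_right hliftE. Qed.

End Inner.

Fact unexchange_rightPl n1 k1 n2 k2 k m a (p p' : C1 n1 k1) (p3 : C3 n2 k2) :
  unexchange_right (a *: p + p') p3 k m
  = a *: unexchange_right p p3 k m + unexchange_right p' p3 k m.
Proof.
apply: lhom_eq; move: k m.
apply: htensor_ind => [k m b x y Hx Hy|b1 m1 b2 m2 p2 p4].
  by rewrite !lhom_lin Hx Hy.
by rewrite lhomPE !unexchange_rightE /unexchange_pure vpurePl hpurePl.
Qed.

Fact unexchange_rightPr n1 k1 n2 k2 k m a (p1 : C1 n1 k1) (p p' : C3 n2 k2) :
  unexchange_right p1 (a *: p + p') k m
  = a *: unexchange_right p1 p k m + unexchange_right p1 p' k m.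
Proof.
apply: lhom_eq; move: k m.
apply: htensor_ind => [k m b x y Hx Hy|b1 m1 b2 m2 p2 p4].
  by rewrite !lhom_lin Hx Hy.
by rewrite lhomPE !unexchange_rightE /unexchange_pure vpurePl hpurePr.
Qed.

Definition unexchange n m : lhom (T n m) (S n m) :=
  vlift (fun k => hlift (U := fun n k => lhom (htensor C2 C4 k m) (S n m))
    (fun n1 k1 n2 k2 => bilin
       (@unexchange_rightPl n1 k1 n2 k2 (k1 + k2) m)
       (@unexchange_rightPr n1 k1 n2 k2 (k1 + k2) m)) n k).

Lemma unexchangeE n1 k1 n2 k2 m1 m2 (p1 : C1 n1 k1) (p3 : C3 n2 k2)
    (p2 : C2 k1 m1) (p4 : C4 k2 m2) :
  unexchange _ _ (vpure (hpure p1 p3) (hpure p2 p4))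
  = hpure (vpure p1 p2) (vpure p3 p4).
Proof.
rewrite /unexchange vliftE hliftE bilinE unexchange_rightE.
by rewrite /unexchange_pure !dsum_in_id.
Qed.

End Inverse.

Lemma exchangeK n m : cancel (exchange n m) (unexchange n m).
Proof.
move: n m; apply: exchange_source_ind => [n m a x y Hx Hy|*].
  by rewrite !lhom_lin Hx Hy.
by rewrite exchangeE unexchangeE.
Qed.

End Exchange.

(** Uniqueness is [exchange_source_ind], injectivity is [exchangeK]. *)
Lemma exchange_exists (F : fieldType) (C1 C2 C3 C4 : bicollection F) :
  exists f : bimor (htensor (vtensor C1 C2) (vtensor C3 C4))
                   (vtensor (htensor C1 C3) (htensor C2 C4)),
    [/\ exchange_spec f,
        (forall g, exchange_spec g -> forall n m, g n m =1 f n m) &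
        bi_injective f].
Proof.
exists (fun n m => exchange C1 C2 C3 C4 n m : {linear _ -> _}); split.
- by move=> n k m n' k' m' p1 p2 p3 p4; exact: exchangeE.
- move=> g gE; apply: exchange_source_ind => [n m a x y Hx Hy|*].
    by rewrite !linearP Hx Hy.
  by rewrite gE [RHS]exchangeE.
- by move=> n m; apply: can_inj (@exchangeK _ _ _ _ _ n m).
Qed.

(** * Concatenating and cutting words of a given shape *)

Section Scaling.
Variables (F : fieldType) (V : lmodType F).

Fact scale_linl b (a a' : F^o) (v : V) : (b *: a + a') *: v = b *: (a *: v) + a' *: v.
Proof. by rewrite scalerDl scalerA. Qed.

Fact scale_linr b (a : F^o) (v v' : V) : a *: (b *: v + v') = b *: (a *: v) + a *: v'.
Proof. by rewrite scalerDr !scalerA mulrC. Qed.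

End Scaling.

Section WordTheory.
Variables (F : fieldType) (C : collection F).
Local Notation word := (word C).

(** Prepending a letter. The word of shape [:: k] is C k itself rather than a
tensor product with the ground field, hence the case distinction. *)
Definition word_cons k s : lhom (C k) (lhom (word s) (word (k :: s))) :=
  match s return lhom (C k) (lhom (word s) (word (k :: s))) with
  | [::] => @bilin F (C k) F^o (C k) (fun c a => a *: c)
      (fun b c c' a => scale_linr b a c c') (fun b c a a' => scale_linl b a a' c)
  | k' :: s' => tpure (C k) (word (k' :: s'))
  end.

(** Detaching the first letter, the inverse of [word_cons]. *)
Definition word_uncons k s : lhom (word (k :: s)) (tensor (C k) (word s)) :=
  match s return lhom (word (k :: s)) (tensor (C k) (word s)) with
  | [::] => @LHom F (C k) (tensor (C k) F^o) (fun c => pure_tensor c 1)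
              (fun a c c' => pure_tensorPl a c c' 1)
  | k' :: s' => lhom_id (tensor (C k) (word (k' :: s')))
  end.

Lemma word_consK k s (c : C k) (w : word s) :
  word_uncons k s (word_cons k s c w) = pure_tensor c w.
Proof.
case: s w => [a|//] /=.
rewrite pure_tensorZl -pure_tensorZr; congr pure_tensor; exact: mulr1.
Qed.

Lemma word_cons_ind k s (Z : word (k :: s) -> Prop) :
  lin_closed Z -> (forall c w, Z (word_cons k s c w)) -> forall w, Z w.
Proof.
case: s Z => [|k' s] Z Zlin Zcons; last exact: tensor_ind.
by move=> c; have := Zcons c (1 : F^o); rewrite /= scale1r.
Qed.

Fact word_cat_subproof1 k s1 s2 (f : lhom (word s1) (lhom (word s2) (word (s1 ++ s2))))
    a c c' w :
  lhom_comp (word_cons k (s1 ++ s2) (a *: c + c')) (f w)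
  = a *: lhom_comp (word_cons k _ c) (f w) + lhom_comp (word_cons k _ c') (f w).
Proof. by apply: lhom_eq => w2; rewrite lhomPE !lhom_compE lhom_lin lhomPE. Qed.

Fact word_cat_subproof2 k s1 s2 (f : lhom (word s1) (lhom (word s2) (word (s1 ++ s2))))
    a c w w' :
  lhom_comp (word_cons k (s1 ++ s2) c) (f (a *: w + w'))
  = a *: lhom_comp (word_cons k _ c) (f w) + lhom_comp (word_cons k _ c) (f w').
Proof.
by apply: lhom_eq => w2; rewrite lhomPE !lhom_compE lhom_lin lhomPE lhom_lin.
Qed.

(** Concatenation of words, by recursion on the shape of the first: the empty
word acts by scalars, and (c w1) w2 = c (w1 w2). *)
Fixpoint word_cat s1 s2 : lhom (word s1) (lhom (word s2) (word (s1 ++ s2))) :=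
  match s1 return lhom (word s1) (lhom (word s2) (word (s1 ++ s2))) with
  | [::] => bilin (@scale_linl F (word s2)) (@scale_linr F (word s2))
  | k :: s => lhom_comp
      (tlift (bilin (@word_cat_subproof1 k s s2 (word_cat s s2))
                    (@word_cat_subproof2 k s s2 (word_cat s s2)))) (word_uncons k s)
  end.

Lemma word_cat_nil s (a : F^o) (w : word s) : word_cat [::] s a w = a *: w.
Proof. by []. Qed.

Lemma word_cat_cons k s1 s2 (c : C k) (w1 : word s1) (w2 : word s2) :
  word_cat (k :: s1) s2 (word_cons k s1 c w1) w2
  = word_cons k (s1 ++ s2) c (word_cat s1 s2 w1 w2).
Proof.
have -> : word_cat (k :: s1) s2 (word_cons k s1 c w1) =
   lhom_comp (word_cons k (s1 ++ s2) c) (word_cat s1 s2 w1).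
  by rewrite [LHS]lhom_compE word_consK tliftE.
by [].
Qed.

(** Concatenations span the words of shape s1 ++ s2. *)
Lemma word_cat_ind s1 s2 (Z : word (s1 ++ s2) -> Prop) :
  lin_closed Z -> (forall w1 w2, Z (word_cat s1 s2 w1 w2)) -> forall w, Z w.
Proof.
elim: s1 Z => [|k s1 IHs] Z Zlin Zcat /=.
  by move=> w; have := Zcat (1 : F^o) w; rewrite word_cat_nil scale1r.
apply: word_cons_ind => // c w.
pose Z' w := Z (word_cons k (s1 ++ s2) c w).
apply: (IHs Z') => [a x y Zx Zy|w1 w2]; rewrite /Z'.
  by rewrite lhom_lin; apply: Zlin.
by rewrite -word_cat_cons.
Qed.

Fact word_split_subproof1 k s1 s2
    (f : lhom (word (s1 ++ s2)) (tensor (word s1) (word s2)))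
    a c c' w :
  tmap (word_cons k s1 (a *: c + c')) (lhom_id (word s2)) (f w)
  = a *: tmap (word_cons k s1 c) (lhom_id _) (f w)
    + tmap (word_cons k s1 c') (lhom_id _) (f w).
Proof. by rewrite lhom_lin tmapPl. Qed.

Fact word_split_subproof2 k s1 s2
    (f : lhom (word (s1 ++ s2)) (tensor (word s1) (word s2)))
    a c w w' :
  tmap (word_cons k s1 c) (lhom_id (word s2)) (f (a *: w + w'))
  = a *: tmap (word_cons k s1 c) (lhom_id _) (f w)
    + tmap (word_cons k s1 c) (lhom_id _) (f w').
Proof. by rewrite !lhom_lin. Qed.

(** Cutting a word of shape s1 ++ s2 after s1, the inverse of concatenation. *)
Fixpoint word_split s1 s2 : lhom (word (s1 ++ s2)) (tensor (word s1) (word s2)) :=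
  match s1 return lhom (word (s1 ++ s2)) (tensor (word s1) (word s2)) with
  | [::] => tpure F^o (word s2) 1
  | k :: s => lhom_comp
      (tlift (bilin (@word_split_subproof1 k s s2 (word_split s s2))
                    (@word_split_subproof2 k s s2 (word_split s s2))))
      (word_uncons k (s ++ s2))
  end.

Lemma word_catK s1 s2 (w1 : word s1) (w2 : word s2) :
  word_split s1 s2 (word_cat s1 s2 w1 w2) = pure_tensor w1 w2.
Proof.
elim: s1 w1 => [a|k s1 IHs].
  rewrite [LHS]pure_tensorZr -pure_tensorZl; congr pure_tensor; exact: mulr1.
elim/word_cons_ind => [a x y Hx Hy|c w].
  rewrite pure_tensorPl -Hx -Hy -lhom_lin; congr (word_split _ _ _).
  by rewrite lhom_lin.
rewrite word_cat_cons [LHS]lhom_compE word_consK tliftE bilinE IHs tmapE.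
by [].
Qed.

End WordTheory.

(** * Concatenating and cutting in T(C) *)

(** The total number of inputs of a word of shape s. *)
Definition inputs (s : seq posnat) : nat := \sum_(k <- s) val k.

Lemma composition_inputs n m (c : composition n m) : inputs (val c) = m.
Proof. by case: c => t /= /eqP <-; rewrite /inputs big_tuple. Qed.

Lemma composition_size n m (c : composition n m) : size (val c) = n.
Proof. exact: size_tuple. Qed.

Fact comp_of_subproof n m (s : seq posnat) (e : size s == n) :
  inputs s = m -> (\sum_(i < n) val (tnth (Tuple e) i) == m)%N.
Proof. by move=> <-; rewrite /inputs -(big_tuple _ _ (Tuple e) xpredT). Qed.

(** The composition with underlying sequence s. *)
Definition comp_of n m (s : seq posnat) (en : size s = n) (em : inputs s = m) :
    composition n m :=
  exist _ (Tuple (introT eqP en)) (comp_of_subproof (introT eqP en) em).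

Lemma comp_ofE n m s (en : size s = n) (em : inputs s = m) (c : composition n m) :
  val c = s :> seq _ -> comp_of en em = c.
Proof. by move=> cs; apply/val_inj/val_inj. Qed.

Fact size_comp_cat n m n' m' (c : composition n m) (c' : composition n' m') :
  size (val c ++ val c') = (n + n')%N.
Proof. by rewrite size_cat !composition_size. Qed.

Fact inputs_comp_cat n m n' m' (c : composition n m) (c' : composition n' m') :
  inputs (val c ++ val c') = (m + m')%N.
Proof. by rewrite /inputs big_cat /= -/(inputs _) -/(inputs _) !composition_inputs. Qed.

(** Concatenation of compositions. *)
Definition comp_cat n m n' m' (c : composition n m) (c' : composition n' m') :
    composition (n + n') (m + m') :=
  comp_of (size_comp_cat c c') (inputs_comp_cat c c').

Section Words.
Variables (F : fieldType) (C : collection F).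
Local Notation word := (word C).
Local Notation words := (words C).

(** The inclusion in T(C)(n, m) of the words of shape c. *)
Definition word_in n m (c : composition n m) : lhom (word (val c)) (words n m) :=
  dsum_inj (fun c : composition n m => word (val c)) c.

Lemma words_ind n m (Z : words n m -> Prop) :
  Z 0 -> lin_closed Z -> (forall c w, Z (word_in c w)) -> forall x, Z x.
Proof. exact: dsum_ind. Qed.

Section Concat.
Variables (n m n' m' : nat).

Definition words_cat_right (c : composition n m) (w : word (val c)) :
    lhom (words n' m') (words (n + n') (m + m')) :=
  dlift (fun c' => lhom_comp (word_in (comp_cat c c')) (word_cat C (val c) (val c') w)).

Fact words_cat_right_linear (c : composition n m) : linear (@words_cat_right c).
Proof.
move=> a w w'; apply: lhom_eq; apply: words_ind => [|b x y Hx Hy|c' w2].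
- by rewrite !lhom_zero.
- by rewrite !lhom_lin Hx Hy.
- by rewrite lhomPE !dliftE !lhom_compE lhom_lin lhomPE lhom_lin.
Qed.

(** Concatenation T(C)(n, m) x T(C)(n', m') -> T(C)(n + n', m + m'). *)
Definition words_cat :
    lhom (words n m) (lhom (words n' m') (words (n + n') (m + m'))) :=
  dlift (fun c => LHom (@words_cat_right_linear c)).

Lemma words_catE c c' w w' :
  words_cat (word_in c w) (word_in c' w')
  = word_in (comp_cat c c') (word_cat C (val c) (val c') w w').
Proof. by rewrite [words_cat _]dliftE [LHS]dliftE. Qed.

End Concat.

Section SplitAt.
Variables (n1 n2 m : nat) (s1 s2 : seq posnat).
Hypotheses (e1 : size s1 = n1) (e2 : size s2 = n2).
Hypothesis (em : (inputs s1 + inputs s2 == m)%N).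

(** The inclusion of pairs of words of shapes s1 and s2 in the horizontal product
of T(C) with itself. *)
Definition words_split_pair :
    lhom (tensor (word s1) (word s2)) (htensor words words (n1 + n2) m) :=
  lhom_comp (dsum_inj (@hsummand F words words (n1 + n2)%N m)
    (split_sum n1 n2, exist _ (inputs s1, inputs s2) em))
   (tmap (word_in (comp_of e1 erefl)) (word_in (comp_of e2 erefl))).

(** Cutting a word of shape s = s1 ++ s2 after s1. The equality is propositional,
so that s can be the shape of any composition of the right size. *)
Definition words_split_at s (e : s1 ++ s2 = s) :
    lhom (word s) (htensor words words (n1 + n2) m) :=
  match e in _ = s' return lhom (word s') _ with
  | erefl => lhom_comp words_split_pair (word_split C s1 s2)
  end.

End SplitAt.

(** The pieces t1, t2 are kept apart from the shapes of c1, c2, since those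
produced by [take] and [drop] are equal to them only propositionally. *)
Lemma words_split_at_cat n1 m1 n2 m2 (c1 : composition n1 m1) (c2 : composition n2 m2)
    t1 t2 (e1 : size t1 = n1) (e2 : size t2 = n2)
    (em : (inputs t1 + inputs t2 == m1 + m2)%N) (e : t1 ++ t2 = val c1 ++ val c2)
    (w1 : word (val c1)) (w2 : word (val c2)) :
  words_split_at e1 e2 em e (word_cat C _ _ w1 w2)
  = hpure (word_in c1 w1) (word_in c2 w2).
Proof.
have t1E : t1 = val c1.
  by rewrite -(take_size_cat t2 e1) e take_size_cat // composition_size.
have t2E : t2 = val c2.
  by rewrite -(drop_size_cat t2 e1) e drop_size_cat // composition_size.
subst t1 t2; rewrite (eq_irrelevance e erefl) [LHS]lhom_compE word_catK {e}.
rewrite /words_split_pair lhom_compE tmapE.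
case: c1 c2 => [[s1 z1] y1] [[s2 z2] y2] /= in w1 w2 e1 e2 em *.
have m1E : inputs s1 = m1 := composition_inputs (exist _ (Tuple z1) y1).
have m2E : inputs s2 = m2 := composition_inputs (exist _ (Tuple z2) y2).
subst m1 m2.
have z1E := eq_irrelevance z1 (introT eqP e1); subst z1.
have z2E := eq_irrelevance z2 (introT eqP e2); subst z2.
rewrite (eq_irrelevance y1 (comp_of_subproof (introT eqP e1) erefl)).
rewrite (eq_irrelevance y2 (comp_of_subproof (introT eqP e2) erefl)).
by rewrite (eq_irrelevance em (eqxx _)).
Qed.

Section Split.
Variables (n1 n2 m : nat).

Fact size_take_comp (c : composition (n1 + n2) m) : size (take n1 (val c)) = n1.
Proof.
by rewrite size_takel // composition_size leq_addr.
Qed.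

Fact size_drop_comp (c : composition (n1 + n2) m) : size (drop n1 (val c)) = n2.
Proof. by rewrite size_drop composition_size addKn. Qed.

Fact inputs_take_drop (c : composition (n1 + n2) m) :
  (inputs (take n1 (val c)) + inputs (drop n1 (val c)) == m)%N.
Proof.
rewrite -[X in _ == X](composition_inputs c) -[X in _ == inputs X](cat_take_drop n1).
by rewrite /inputs big_cat.
Qed.

(** Cutting the words of length n1 + n2 after their n1-th letter. *)
Definition words_split : lhom (words (n1 + n2) m) (htensor words words (n1 + n2) m) :=
  dlift (fun c => words_split_at (size_take_comp c) (size_drop_comp c)
                    (inputs_take_drop c) (cat_take_drop n1 (val c))).

End Split.

Lemma words_catK n1 m1 n2 m2 (x1 : words n1 m1) (x2 : words n2 m2) :
  words_split n1 n2 (m1 + m2) (words_cat _ _ _ _ x1 x2) = hpure x1 x2.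
Proof.
elim/words_ind: x1 => [|a x y Hx Hy|c1 w1].
- by rewrite hpure0l lhom_zero [X in words_split _ _ _ X](_ : _ = 0) // lhom_zero.
- by rewrite hpurePl -Hx -Hy -lhom_lin lhom_lin lhomPE.
elim/words_ind: x2 => [|a x y Hx Hy|c2 w2].
- by rewrite hpure0r !lhom_zero.
- by rewrite hpurePr -Hx -Hy -!lhom_lin.
by rewrite words_catE [LHS]dliftE words_split_at_cat.
Qed.

Lemma words_cat_ind n1 n2 (Z : forall m, words (n1 + n2) m -> Prop) :
  (forall m, Z m 0) -> (forall m, lin_closed (@Z m)) ->
  (forall m1 m2 (x1 : words n1 m1) (x2 : words n2 m2),
     Z _ (words_cat n1 m1 n2 m2 x1 x2)) ->
  forall m x, Z m x.
Proof.
move=> Z0 Zlin Zcat m; apply: words_ind => // -[[s z] y].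
have mE : (inputs (take n1 s) + inputs (drop n1 s) = m)%N :=
  eqP (inputs_take_drop (exist _ (Tuple z) y)).
have e1 : size (take n1 s) = n1 := size_take_comp (exist _ (Tuple z) y).
have e2 : size (drop n1 s) = n2 := size_drop_comp (exist _ (Tuple z) y).
case: m / mE y => y.
pose c1 := comp_of e1 erefl; pose c2 := comp_of e2 erefl.
have -> : exist _ (Tuple z) y = comp_cat c1 c2.
  by apply/esym/comp_ofE; rewrite /= cat_take_drop.
apply: word_cat_ind => [a u v Zu Zv|w1 w2]; first by rewrite lhom_lin; apply: Zlin.
by rewrite -words_catE.
Qed.

End Words.

(** * The isomorphism for words *)

Section WordsExchange.
Variables (F : fieldType) (C1 C2 : bicollection F) (C : collection F).
Local Notation words := (words C).

Let S := htensor (vtensor C1 words) (vtensor C2 words).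
Let T := vtensor (htensor C1 C2) words.

(** Concatenation, as a map of bicollections. *)
Definition words_concat n m : lhom (htensor words words n m) (words n m) :=
  hlift (fun n1 m1 n2 m2 => words_cat C n1 m1 n2 m2) n m.

Lemma words_concatE n1 m1 n2 m2 (x1 : words n1 m1) (x2 : words n2 m2) :
  words_concat _ _ (hpure x1 x2) = words_cat C _ _ _ _ x1 x2.
Proof. exact: hliftE. Qed.

(** Concatenation in the second factor of a vertical product. *)
Definition vconcat n m :
    lhom (vtensor (htensor C1 C2) (htensor words words) n m) (T n m) :=
  vlift (fun k => @bilin F _ _ (T n m) (fun p x => vpure p (words_concat k m x))
    (fun a p p' x => vpurePl a p p' _)
    (fun a p x x' => etrans (congr1 (vpure p) (lhom_lin _ a x x')) (vpurePr a _ _ _))).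

Lemma vconcatE n k m (p : htensor C1 C2 n k) (x : htensor words words k m) :
  vconcat n m (vpure p x) = vpure p (words_concat k m x).
Proof. exact: vliftE. Qed.

(** The isomorphism (p1 v x1) h (p2 v x2) |-> (p1 h p2) v (x1 x2). *)
Definition words_merge n m : lhom (S n m) (T n m) :=
  lhom_comp (vconcat n m) (exchange C1 words C2 words n m).

Lemma words_mergeE n1 k1 m1 n2 k2 m2 (p1 : C1 n1 k1) (x1 : words k1 m1)
    (p2 : C2 n2 k2) (x2 : words k2 m2) :
  words_merge _ _ (hpure (vpure p1 x1) (vpure p2 x2))
  = vpure (hpure p1 p2) (words_cat C _ _ _ _ x1 x2).
Proof. by rewrite /words_merge lhom_compE exchangeE vconcatE words_concatE. Qed.

Section Unmerge.
Variables (n1 k1 n2 k2 m : nat).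

(** Cutting x lands in the summand (k1, k2) of matching intermediate numbers, so
[unexchange] loses nothing here. *)
Definition words_unmerge_pure (p1 : C1 n1 k1) (p2 : C2 n2 k2) (x : words (k1 + k2) m) :
    S (n1 + n2) m :=
  unexchange C1 words C2 words _ _ (vpure (hpure p1 p2) (words_split C k1 k2 m x)).

Fact words_unmerge_pure_linear p1 p2 : linear (@words_unmerge_pure p1 p2).
Proof. by move=> a x y; rewrite /words_unmerge_pure lhom_lin vpurePr lhom_lin. Qed.

Fact words_unmerge_purePl a p p' p2 :
  LHom (@words_unmerge_pure_linear (a *: p + p') p2)
  = a *: LHom (@words_unmerge_pure_linear p p2)
    + LHom (@words_unmerge_pure_linear p' p2).
Proof.
apply: lhom_eq => x; rewrite lhomPE /= /words_unmerge_pure.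
by rewrite hpurePl vpurePl lhom_lin.
Qed.

Fact words_unmerge_purePr a p1 p p' :
  LHom (@words_unmerge_pure_linear p1 (a *: p + p'))
  = a *: LHom (@words_unmerge_pure_linear p1 p)
    + LHom (@words_unmerge_pure_linear p1 p').
Proof.
apply: lhom_eq => x; rewrite lhomPE /= /words_unmerge_pure.
by rewrite hpurePr vpurePl lhom_lin.
Qed.

End Unmerge.

(** The inverse of [words_merge]. *)
Definition words_unmerge n m : lhom (T n m) (S n m) :=
  vlift (fun k => hlift (U := fun n k => lhom (words k m) (S n m))
    (fun n1 k1 n2 k2 => bilin (@words_unmerge_purePl n1 k1 n2 k2 m)
                              (@words_unmerge_purePr n1 k1 n2 k2 m)) n k).

Lemma words_unmergeE n1 k1 n2 k2 m1 m2 (p1 : C1 n1 k1) (p2 : C2 n2 k2)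
    (x1 : words k1 m1) (x2 : words k2 m2) :
  words_unmerge _ _ (vpure (hpure p1 p2) (words_cat C _ _ _ _ x1 x2))
  = hpure (vpure p1 x1) (vpure p2 x2).
Proof.
rewrite /words_unmerge vliftE hliftE bilinE /= /words_unmerge_pure words_catK.
exact: unexchangeE.
Qed.

Lemma words_mergeK n m : cancel (words_merge n m) (words_unmerge n m).
Proof.
move: n m; apply: exchange_source_ind => [n m a x y Hx Hy|*].
  by rewrite !lhom_lin Hx Hy.
by rewrite words_mergeE words_unmergeE.
Qed.

Lemma words_unmergeK n m : cancel (words_unmerge n m) (words_merge n m).
Proof.
elim/vtensor_ind => [a x y Hx Hy|k p].
  by rewrite !lhom_lin Hx Hy.
move: n k p; apply: htensor_ind => [n k a p p' Hp Hp' x|n1 k1 n2 k2 p1 p2].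
  by rewrite vpurePl !lhom_lin Hp Hp'.
move: m; apply: words_cat_ind => [m|m a x y Hx Hy|m1 m2 x1 x2].
- by rewrite vpure0r !lhom_zero.
- by rewrite vpurePr !lhom_lin Hx Hy.
- by rewrite words_unmergeE words_mergeE.
Qed.

Lemma words_vtensor_iso : bi_isomorphic S T.
Proof.
exists (fun n m => words_merge n m : {linear _ -> _}).
exists (fun n m => words_unmerge n m : {linear _ -> _}) => n m.
by split; [exact: words_mergeK|exact: words_unmergeK].
Qed.

End WordsExchange.

Theorem proposition11 (R : realType) :
  (forall C1 C2 C3 C4 : bicollection R[i],
    exists f : bimor ((C1 ⊠ C2) ⊗h (C3 ⊠ C4))%bicol
                     ((C1 ⊗h C3) ⊠ (C2 ⊗h C4))%bicol,
      [/\ exchange_spec f,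
          (forall g, exchange_spec g -> forall n m, g n m =1 f n m) &
          bi_injective f])
  /\
  (forall (C1 C2 : bicollection R[i]) (C : collection R[i]),
    bi_isomorphic ((C1 ⊠ words C) ⊗h (C2 ⊠ words C))%bicol
                  ((C1 ⊗h C2) ⊠ words C)%bicol).
Proof.
split=> [C1 C2 C3 C4|C1 C2 C]; first exact: exchange_exists.
exact: words_vtensor_iso.
Qed.
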